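(* Let $n$ be an odd prime, let $q\in\mathbb{C}$ be a primitive $n$-th root of unity, and let $B=\begin{pmatrix} a & b\\ c& d\end{pmatrix}\in SL_2(\mathbb{Z})$. Let $C=(c_{j,k})_{j,k=0}^{n-1}$ be the matrix associated to $B$ with entries $$c_{j,k}=q^{-b^{-1}d(j-ak)^2-2ck(j-ak)-ack^2},$$ where $b^{-1}$ is the multiplicative inverse of $b$ in $\mathbb{Z}/n\mathbb{Z}$. Then $$\operatorname{Tr}(C)=\left(\frac{K_B}{n}\right)\frac{1+i^{-n}}{1+i^{-1}}\sqrt{n},$$ where $K_B:=-(b^{-1}d(1-a)^2+c(2-a))$, $\left(\frac{\cdot}{n}\right)$ is the Legendre symbol, and $i=\sqrt{-1}$.
   Context: Exponents of $q$ are read modulo $n$. For $x\not\equiv 0\pmod n$, the Legendre symbol $\left(\frac{x}{n}\right)$ is $1$ if $x$ is a square modulo $n$ and $-1$ otherwise; it depends only on the residue class of $x$ modulo $n$. The matrix $C$ arises as follows. Let $\mathcal{W}_q$ be the $\mathbb{C}$-algebra of noncommuting Laurent polynomials in $l,m$ with $lm=q^2ml$, with basis $e_{r,s}=q^{-rs}l^rm^s$ ($r,s\in\mathbb{Z}$), on which $SL_2(\mathbb{Z})$ acts by the automorphisms $\begin{pmatrix} a & b\\ c& d\end{pmatrix}\cdot e_{p,t}=e_{ap+bt,\,cp+dt}$. Let $\rho:\mathcal{W}_q\to M_n(\mathbb{C})$ be the surjective homomorphism sending $l$ to the cyclic permutation matrix with $(j,k)$ entry $1$ if $j\equiv k+1\pmod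 n$ and $0$ otherwise, and $m$ to the diagonal matrix with entries $q^{-2j}$, $0\le j\le n-1$. The kernel of $\rho$ is preserved by $B$, and $C$ is a matrix whose conjugation action $X\mapsto CXC^{-1}$ on $M_n(\mathbb{C})$ is the automorphism induced by $B$; such a matrix is unique up to scalar multiples, and $C$ denotes the specific matrix displayed in the claim.
   Formalization: The formula fails for some primitive q (n=3, q=e^{-2πi/3}, a=0, b=1, c=-1, d=1); it is proved for q=e^{2πi/n}, and with an extra factor (m/n) for q=e^{2πim/n}; b and K_B are assumed nonzero mod n so that b^{-1} and the Legendre symbol are defined. *)

(* Defs.v *)
From mathcomp Require Import all_boot all_order all_algebra.
From mathcomp Require Import complex.
From mathcomp Require Import reals trigo.

Set Implicit Arguments.
Unset Strict Implicit.
Unset Printing Implicit Defensive.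

Import Order.TTheory GRing.Theory Num.Theory.
Local Open Scope ring_scope.
Local Open Scope complex_scope.

(* For prime n, 'F_n is Z/nZ. *)

Definition legendre (n : nat) (x : 'F_n) : int :=
  if x == 0 then 0 else if [exists y : 'F_n, x == y ^+ 2] then 1 else -1.

(* e^(2 i pi / n). The sign of a quadratic Gauss sum depends on which primitive
   root is used, so a primitive n-th root of unity q is compared with this
   one. *)
Definition zeta (R : realType) (n : nat) : R[i] :=
  cos (2 * pi / n%:R) +i* sin (2 * pi / n%:R).

(* [x : 'F_n] stands for its representative in {0, ..., n - 1}. *)
Definition qpow (R : realType) (n : nat) (q : R[i]) (x : 'F_n) : R[i] :=
  q ^+ (x : nat).

Definition Cmx (R : realType) (n : nat) (q : R[i]) (B : 'M[int]_2) :
    'M[R[i]]_n :=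
  let a : 'F_n := (B 0 0)%:~R in let b : 'F_n := (B 0 1)%:~R in
  let c : 'F_n := (B 1 0)%:~R in let d : 'F_n := (B 1 1)%:~R in
  \matrix_(j < n, k < n)
    let j' : 'F_n := (j : nat)%:R in let k' : 'F_n := (k : nat)%:R in
    qpow q (- (b^-1 * d * (j' - a * k') ^+ 2)
            - 2 * c * k' * (j' - a * k') - a * c * k' ^+ 2).

Definition KB (n : nat) (B : 'M[int]_2) : 'F_n :=
  let a : 'F_n := (B 0 0)%:~R in let b : 'F_n := (B 0 1)%:~R in
  let c : 'F_n := (B 1 0)%:~R in let d : 'F_n := (B 1 1)%:~R in
  - (b^-1 * d * (1 - a) ^+ 2 + c * (2 - a)).

(* Main.v *)
(** The trace is the quadratic Gauss sum [\sum_k q ^ (K k^2)], [K = KB n B].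
    Splitting the nonzero classes into squares and [K] times squares reduces it,
    up to the sign [legendre K], to [\sum_k zeta ^ (k^2)].
    The sign of the latter is found as in Gauss: with [x = zeta^-2], the
    Gaussian binomials satisfy [(-1)^k (n-1 choose k)_x = zeta^(k (k+1))], so
    their alternating sum is, after completing the square, the Gauss sum, while
    the recurrence of the Rogers-Szego polynomials at [-1] turns it into
    the product of [zeta^j - zeta^-j = 2 i sin (2 pi j / n)] over odd [j < n].
    The signs of the sines give the argument, and
    [\prod_(0 < k < n) (1 - x^k) = n] gives the modulus. *)

Require Import Defs.
From mathcomp Require Import all_boot all_order all_algebra.
From mathcomp Require Import complex.
From mathcomp Require Import reals trigo.
From mathcomp Require Import ring zify.

Import Order.TTheory GRing.Theory Num.Theory.
Local Open Scope ring_scope.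
Local Open Scope complex_scope.

(** * Gaussian binomials and Rogers-Szego polynomials *)

Fixpoint qbinom {R : comNzRingType} (x : R) (m k : nat) : R :=
  match m, k with
  | 0, 0 => 1
  | 0, _.+1 => 0
  | _.+1, 0 => 1
  | m'.+1, k'.+1 => qbinom x m' k' + x ^+ k * qbinom x m' k
  end.

Section QBinomial.
Variables (R : comNzRingType) (x : R).

Lemma qbinom0 m : qbinom x m 0 = 1.
Proof. by case: m. Qed.

Lemma qbinomS m k :
  qbinom x m.+1 k.+1 = qbinom x m k + x ^+ k.+1 * qbinom x m k.+1.
Proof. by []. Qed.

Lemma qbinom_small m k : (m < k)%N -> qbinom x m k = 0.
Proof.
elim: m k => [|m IHm] [|k] // lt_mk.
by rewrite qbinomS !IHm ?mulr0 ?addr0 // ltnW.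
Qed.

(* The mirror image of the recurrence [qbinomS], multiplied by [x ^+ k.+1] so
   that no truncated exponent [m - k] appears. *)
Lemma qbinomS_mirror m k :
  x ^+ k.+1 * qbinom x m.+1 k.+1 =
  x ^+ k.+1 * qbinom x m k.+1 + x ^+ m.+1 * qbinom x m k.
Proof.
elim: m k => [|m IHm] [|k].
- by rewrite /= !expr1; ring.
- by rewrite /= !mulr0 !addr0 mulr0.
- have := IHm 0%N; rewrite (qbinomS m.+1) !qbinom0 !expr1 => E.
  rewrite mulrDr {1}E [qbinom x m.+1 1]qbinomS qbinom0 expr1.
  by rewrite [x ^+ m.+2]exprS; ring.
(* The induction hypothesis serves at [k.+1] and, multiplied by one more [x], at [k]. *)
rewrite (qbinomS m.+1) mulrDr {1}IHm.
have E : x ^+ k.+2 * qbinom x m.+1 k.+1 =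
  x * (x ^+ k.+1 * qbinom x m k.+1 + x ^+ m.+1 * qbinom x m k).
  by rewrite -IHm mulrA -exprS.
rewrite E !qbinomS !mulrDr !exprS; ring.
Qed.

(** Subtracting the mirrored Pascal recurrence from the plain one cancels the terms in
    [qbinom x m k.+1]. *)
Lemma qbinom_absorb m k :
  (1 - x ^+ k.+1) * qbinom x m.+1 k.+1 = (1 - x ^+ m.+1) * qbinom x m k.
Proof. by rewrite mulrBl qbinomS_mirror qbinomS; ring. Qed.

Lemma qbinomSS m k :
  qbinom x m.+2 k.+1 =
  qbinom x m.+1 k + qbinom x m.+1 k.+1 - (1 - x ^+ m.+1) * qbinom x m k.
Proof. by rewrite -qbinom_absorb qbinomS; ring. Qed.

Definition rogers_szego m : {poly R} := \poly_(k < m.+1) qbinom x m k.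

Lemma coef_rogers_szego m k : (rogers_szego m)`_k = qbinom x m k.
Proof.
by rewrite coef_poly; case: ltnP => // le_mk; rewrite qbinom_small.
Qed.

Lemma rogers_szegoSS m :
  rogers_szego m.+2 = ('X + 1) * rogers_szego m.+1
                      - (1 - x ^+ m.+1) *: ('X * rogers_szego m).
Proof.
apply/polyP => -[|k]; rewrite mulrDl mul1r !(coefD, coefN, coefZ, coefXM) /=.
  by rewrite !coef_rogers_szego !qbinom0; ring.
by rewrite !coef_rogers_szego qbinomSS.
Qed.

(** The factor ['X + 1] vanishes at -1, so the recurrence there relates only indices of equal
    parity. *)
Lemma rogers_szegoN1 m :
  (rogers_szego m.*2).[-1] = \prod_(i < m) (1 - x ^+ i.*2.+1).
Proof.
elim: m => [|m IHm].
  rewrite big_ord0 /rogers_szego horner_poly big_ord1 /=; ring.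
by rewrite doubleS rogers_szegoSS !hornerE IHm big_ord_recr /=; ring.
Qed.

Lemma sum_qbinomN1 m :
  \sum_(k < m.*2.+1) (-1) ^+ k * qbinom x m.*2 k =
  \prod_(i < m) (1 - x ^+ i.*2.+1).
Proof.
by rewrite -rogers_szegoN1 horner_poly; apply: eq_bigr => k _; rewrite mulrC.
Qed.
End QBinomial.

(** As [x ^+ n = 1], absorption forces [qbinom x n k.+1 = 0] for [k.+1 < n]; Pascal's rule then
    makes consecutive entries of row [n.-1] proportional. *)
Lemma qbinom_unity_root (F : fieldType) n (x : F) k :
    n.-primitive_root x -> (k < n)%N ->
  (-1) ^+ k * qbinom x n.-1 k = \prod_(i < k) x ^- i.+1.
Proof.
move=> x_prim; have x0 : x != 0.
  by rewrite (prim_root_eq0 x_prim) -lt0n (prim_order_gt0 x_prim).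
elim: k => [|k IHk] lt_kn; first by rewrite qbinom0 big_ord0 mulr1.
have /eqP := qbinom_absorb F x n.-1 k.
rewrite prednK ?(prim_order_gt0 x_prim) // (prim_expr_order x_prim) subrr mul0r.
rewrite mulf_eq0 subr_eq0 eq_sym -(prim_order_dvd x_prim) gtnNdvd //=.
rewrite -{1}[n]prednK ?(prim_order_gt0 x_prim) // qbinomS => /eqP E.
rewrite big_ord_recr /= -IHk ?(ltnW lt_kn) //.
have -> : qbinom x n.-1 k = - (x ^+ k.+1 * qbinom x n.-1 k.+1).
  by apply/eqP; rewrite -addr_eq0; exact/eqP.
by rewrite exprSr; field; rewrite expf_neq0.
Qed.

Lemma odd_doubleE n : odd n -> n = n./2.*2.+1.
Proof. by move=> n_odd; rewrite -[LHS]odd_double_half n_odd. Qed.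

Lemma sum_periodic_shift {V : zmodType} (f : nat -> V) n s :
  (forall k, f (k + n)%N = f k) ->
  \sum_(k < n) f (k + s)%N = \sum_(k < n) f k.
Proof.
move=> fn; elim: s => [|s <-]; first by under eq_bigr do rewrite addn0.
have := @big_ord_recl V 0 +%R n (fun k : 'I_n.+1 => f (k + s)%N).
rewrite big_ord_recr /= add0n [(n + s)%N]addnC fn addrC => /addrI ->.
by apply: eq_bigr => k _; rewrite /bump add1n addnS addSn.
Qed.

(** * The Gauss sum as a product *)

Section GaussProduct.
Variables (F : fieldType) (n : nat) (z : F).
Hypotheses (n_odd : odd n) (z_prim : n.-primitive_root z).

Lemma sum_expr_sqr_prod :
  \sum_(k < n) z ^+ (k ^ 2) =
  \prod_(i < n./2) (z ^+ i.*2.+1 - z ^- i.*2.+1).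
Proof.
have nE := odd_doubleE n n_odd; set N := n./2 in nE *.
have z0 : z != 0.
  by rewrite (prim_root_eq0 z_prim) -lt0n (prim_order_gt0 z_prim).
have zn := prim_expr_order z_prim.
have x_prim : n.-primitive_root (z ^- 2).
  (* Modulo [n], [N.*2 = n - 1] represents -1. *)
  have -> : z ^- 2 = z ^+ (N.*2 * 2).
    apply: (mulIf (expf_neq0 2 z0)); rewrite mulVf ?expf_neq0 // -exprD.
    by rewrite -{2}[2%N]mul1n -mulnDl addn1 -nE exprM zn expr1n.
  by rewrite prim_root_exp_coprime // coprimeMl coprime2n n_odd {1}nE coprimenS.
(* [N.+1] is the inverse of 2 modulo [n], so shifting by it turns [k ^ 2] into [k * k.+1] plus a
   constant. *)
rewrite -(@sum_periodic_shift _ (fun k => z ^+ (k ^ 2)) n N.+1); last first.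
  move=> k; have -> : ((k + n) ^ 2 = k ^ 2 + n * (2 * k + n))%N by nia.
  by rewrite exprD exprM zn expr1n mulr1.
transitivity (z ^+ (N.+1 ^ 2) * \sum_(k < n) \prod_(i < k) (z ^- 2) ^- i.+1).
  rewrite mulr_sumr; apply: eq_bigr => k _.
  have -> : \prod_(i < k) (z ^- 2) ^- i.+1 = z ^+ (k * k.+1).
    elim: (k : nat) => [|j IHj]; first by rewrite big_ord0.
    rewrite big_ord_recr /= IHj exprVn invrK -exprM -exprD; congr (_ ^+ _); nia.
  rewrite -exprD.
  have -> : ((k + N.+1) ^ 2 = n * k + (N.+1 ^ 2 + k * k.+1))%N by nia.
  by rewrite exprD exprM zn expr1n mul1r.
under eq_bigr do rewrite -(qbinom_unity_root _ n _ _ x_prim) //.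
rewrite nE sum_qbinomN1.
have -> : (N.+1 ^ 2 = N ^ 2 + n)%N by nia.
rewrite exprD zn mulr1.
(* [N ^ 2] is the sum of the first [N] odd numbers; each factor receives one odd power of [z], which
   makes it antisymmetric. *)
have -> : z ^+ (N ^ 2) = \prod_(i < N) z ^+ i.*2.+1.
  elim: (N) => [|j IHj]; first by rewrite big_ord0.
  by rewrite big_ord_recr /= -IHj -exprD; congr (_ ^+ _); nia.
rewrite -big_split; apply: eq_bigr => i _ /=.
rewrite mulrBr mulr1 exprVn -exprM mulnC exprM expr2.
by field; rewrite expf_neq0.
Qed.
End GaussProduct.

(** * The modulus of the product *)

Lemma prod_double {R : comNzRingType} (f : nat -> R) m :
  \prod_(k < m.*2) f k = \prod_(i < m) (f i.*2 * f i.*2.+1).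
Proof.
elim: m => [|m IHm]; first by rewrite !big_ord0.
by rewrite doubleS !big_ord_recr /= IHm mulrA.
Qed.

(** Evaluate the factorization of [(X^n - 1) / (X - 1)] at 1. *)
Lemma prod_1subX_prim_root (F : fieldType) n (x : F) :
  n.-primitive_root x -> \prod_(k < n.-1) (1 - x ^+ k.+1) = n%:R.
Proof.
move=> x_prim; have n_gt0 := prim_order_gt0 x_prim.
have X1_neq0 : 'X - 1%:P != 0 :> {poly F} by rewrite polyXsubC_eq0.
have := factor_Xn_sub_1 x_prim; rewrite subrX1 big_mkord.
rewrite -(prednK n_gt0) big_ord_recl expr0 => /(mulfI X1_neq0).
move=> /(congr1 (horner^~ 1)).
rewrite horner_prod horner_sum.
under eq_bigr do rewrite hornerXsubC.
under [RHS]eq_bigr do rewrite hornerXn expr1n.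
by rewrite sumr_const card_ord.
Qed.

(** In the product of the [1 - z^(2k)], pair each odd [j] with the even [n - j]: [(1 - z^(2j)) (1 -
    z^(-2j)) = - (z^j - z^-j)^2]. *)
Lemma prod_sqr_prim_root (F : fieldType) n (z : F) :
    odd n -> n.-primitive_root z ->
  \prod_(i < n./2) - (z ^+ i.*2.+1 - z ^- i.*2.+1) ^+ 2 = n%:R.
Proof.
move=> n_odd z_prim.
have nE := odd_doubleE n n_odd; set N := n./2 in nE *.
have z0 : z != 0 by rewrite (prim_root_eq0 z_prim) nE.
have x_prim : n.-primitive_root (z ^+ 2).
  by rewrite prim_root_exp_coprime // coprime2n.
rewrite -(prod_1subX_prim_root _ _ _ x_prim).
have -> : n.-1 = N.*2 by rewrite nE.
rewrite (prod_double (fun k => 1 - (z ^+ 2) ^+ k.+1)) big_split /=.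
rewrite [X in _ = _ * X](reindex_inj rev_ord_inj) /= -big_split /=.
apply: eq_bigr => i _.
have -> : (z ^+ 2) ^+ (N - i.+1).*2.+2 = z ^- i.*2.+1 ^+ 2.
  apply: (mulIf (expf_neq0 2 (expf_neq0 i.*2.+1 z0))).
  rewrite -exprMn mulVf ?expf_neq0 // expr1n -exprM -exprM -exprD.
  have -> : (2 * (N - i.+1).*2.+2 + i.*2.+1 * 2 = n * 2)%N.
    have := ltn_ord i; lia.
  by rewrite exprM (prim_expr_order z_prim) expr1n.
by rewrite -exprM mulnC exprM; field; rewrite expf_neq0.
Qed.

(** With [m = n./2], this counts the negative sines in [prod_sin]. *)
Lemma sum_odd_gt m : (\sum_(i < m) (m < i.*2.+1) = m./2)%N.
Proof.
(* A separate bound [k] can be split at [uphalf m] without touching [m] in the summand; the terms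
   are 0 before the split and 1 after it. *)
have sum_half k : k = (uphalf m + m./2)%N ->
    (\sum_(i < k) (m < i.*2.+1) = m./2)%N.
  move=> ->; rewrite big_split_ord /= big1 => [|i _].
    2: by have := ltn_ord i; lia.
  rewrite (eq_bigr (fun=> 1%N)) => [|i _]; last by lia.
  by rewrite sum1_card card_ord.
by apply: sum_half; rewrite uphalf_half -addnA addnn odd_double_half.
Qed.

(** * The sign of the Gauss sum at [zeta] *)

Section GaussSum.
Variables (R : realType) (n : nat).
Hypothesis n_odd : odd n.
Let n_gt0 : 0 < n%:R :> R.
Proof. by rewrite ltr0n odd_gt0. Qed.

Local Notation theta j := (2 * pi / n%:R * j%:R : R).

Lemma zetaX j : zeta R n ^+ j = cos (theta j) +i* sin (theta j).
Proof.
elim: j => [|j IHj]; first by rewrite mulr0 cos0 sin0.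
have -> : theta j.+1 = 2 * pi / n%:R + theta j by rewrite -natr1; ring.
rewrite exprS IHj /zeta cosD sinD; simpc.
by congr (_ +i* _); ring.
Qed.

Lemma zetaXV j : zeta R n ^- j = cos (theta j) -i* sin (theta j).
Proof.
rewrite zetaX -[LHS]mul1r.
have c :
    (cos (theta j) -i* sin (theta j)) * (cos (theta j) +i* sin (theta j)) = 1.
  simpc; apply/eqP; rewrite eq_complex /= -!expr2 cos2Dsin2 eqxx /=.
  by apply/eqP; ring.
rewrite -c mulfK //.
apply/eqP => E; move: c; rewrite E mulr0 => /eqP; by rewrite eq_sym oner_eq0.
Qed.

Lemma zetaX_sub j :
  zeta R n ^+ j - zeta R n ^- j = 'i%C * (2 * sin (theta j))%:C.
Proof.
rewrite zetaXV zetaX; apply/eqP; rewrite eq_complex /=.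
by apply/andP; split; apply/eqP; ring.
Qed.

Lemma zeta_order : (0 < n)%N -> zeta R n ^+ n = 1.
Proof.
move=> n0; rewrite zetaX divfK ?pnatr_eq0 -?lt0n //.
by rewrite mulrC mulr_natr cos2pi sin2pi.
Qed.

Lemma sgr_sin_theta j : (0 < j < n)%N ->
  Num.sg (sin (theta j)) = (-1) ^+ (n./2 < j)%N.
Proof.
have nE := odd_doubleE n n_odd; set N := n./2 in nE *.
move=> /andP[j0 jn].
have pi0 := pi_gt0 R.
have thetaE : theta j = pi * (2 * j)%:R / n%:R by rewrite natrM; ring.
have [jN|jN] := leqP j N; rewrite ?expr0 ?expr1.
  apply/gtr0_sg/sin_gt0_pi/andP; rewrite thetaE; split.
    by rewrite !mulr_gt0 ?invr_gt0 ?n_gt0 // ltr0n; lia.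
  by rewrite ltr_pdivrMr // ltr_pM2l // ltr_nat nE; lia.
apply/ltr0_sg; rewrite -[theta j](subrK pi) sinDpi oppr_lt0.
apply/sin_gt0_pi/andP; rewrite thetaE subr_gt0 ltrBlDr; split.
  by rewrite ltr_pdivlMr // ltr_pM2l // ltr_nat nE; lia.
rewrite -mulr2n -[pi *+ 2]mulr_natr ltr_pdivrMr // -mulrA ltr_pM2l //.
by rewrite -natrM ltr_nat ltn_pmul2l.
Qed.

(** A real number is its sign times the square root of its square; the square comes from
    [prod_sqr_prim_root], the sign from counting negative sines. *)
Lemma prod_sin : n.-primitive_root (zeta R n) ->
  \prod_(i < n./2) (2 * sin (theta i.*2.+1)) = (-1) ^+ n./2./2 * Num.sqrt n%:R.
Proof.
have nE := odd_doubleE n n_odd; set N := n./2 in nE *.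
move=> z_prim; set r := LHS.
have -> : n%:R = r ^+ 2.
  apply: complexI; rewrite rmorphXn rmorph_prod rmorph_nat /=.
  rewrite -(prod_sqr_prim_root _ _ _ n_odd z_prim) -prodrXl.
  by apply: eq_bigr => i _; rewrite zetaX_sub exprMn sqr_i mulN1r opprK.
rewrite sqrtr_sqr [LHS]numEsg; congr (_ * _).
rewrite /r -sum_odd_gt expr_sum.
rewrite (big_morph (@Num.sg R) (@sgrM R) (@sgr1 R)).
apply: eq_bigr => i _; rewrite sgrM gtr0_sg // mul1r sgr_sin_theta //.
by have := ltn_ord i; rewrite /= {1}nE; lia.
Qed.

Lemma sum_zeta_sqr : n.-primitive_root (zeta R n) ->
  \sum_(k < n) zeta R n ^+ (k ^ 2) =
  (1 + 'i%C ^- n) / (1 + 'i%C^-1) * (Num.sqrt (n%:R : R))%:C.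
Proof.
have nE := odd_doubleE n n_odd; set N := n./2 in nE *.
move=> z_prim; rewrite sum_expr_sqr_prod //.
under eq_bigr do rewrite zetaX_sub.
rewrite big_split /= prodr_const card_ord -rmorph_prod /= prod_sin //.
rewrite rmorphM rmorphXn rmorphN rmorph1 /= mulrA; congr (_ * _).
have i0 : 'i%C != 0 :> R[i].
  by apply/eqP => /eqP; rewrite eq_complex /= oner_eq0 andbF.
have iV : 'i%C^-1 = - 'i%C :> R[i].
  apply: (mulIf i0); rewrite mulVf // mulNr -expr2 sqr_i opprK //.
have dN : 1 - 'i%C != 0 :> R[i].
  by apply/eqP => /eqP; rewrite eq_complex /= subr0 oner_eq0.
rewrite -exprVn iV.
have -> : (- 'i%C) ^+ n = - (-1) ^+ N * 'i%C :> R[i].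
  by rewrite {1}nE exprS -mul2n exprM sqrrN sqr_i; ring.
apply: (mulIf dN); rewrite divfK //.
(* The powers of [i] and the sign combine to 1 if [n] is 1 modulo 4, and to [i] if it is 3. *)
have -> : 'i%C ^+ N * (-1) ^+ N./2 = 'i%C ^+ odd N :> R[i].
  rewrite -{1}(odd_double_half N) exprD -mul2n exprM sqr_i -mulrA.
  by rewrite -expr2 sqrr_sign mulr1.
rewrite -[(-1) ^+ N]signr_odd.
case: (odd N); rewrite ?expr1 ?expr0; last by ring.
by rewrite mulrBr -expr2 sqr_i; ring.
Qed.
End GaussSum.

(** * Sums over squares and nonsquares in a finite field *)

Section SquareSums.
Variable F : finFieldType.
Hypothesis two_neq0 : 2 != 0 :> F.

Local Notation units := [set x : F | x != 0].
Local Notation squares := [set x ^+ 2 | x in units].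

(** Each nonzero square has exactly two roots, [y] and [- y], distinct because 2 is nonzero. *)
Lemma sum_comp_sqr (V : nmodType) (f : F -> V) :
  \sum_k f (k ^+ 2) = f 0 + (\sum_(r in squares) f r) *+ 2.
Proof.
rewrite (bigD1 0) //= expr0n /=; congr (_ + _).
rewrite (eq_bigl [in units]) => [|x]; last by rewrite [RHS]in_set.
rewrite (partition_big_imset (fun x : F => x ^+ 2)) -sumrMnl /=.
apply: eq_bigr => _ /imsetP[y y_unit ->]; move: y_unit; rewrite inE => y0.
have yN : y != - y by rewrite -addr_eq0 -mulr2n -mulr_natl mulf_neq0.
rewrite (eq_bigr (fun=> f (y ^+ 2))) => [|x /andP[_ /eqP -> //]].
rewrite sumr_const; congr (_ *+ _).
transitivity #|[set y; - y]|; last by rewrite cards2 yN.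
apply: eq_card => x; rewrite !inE unfold_in /= eqf_sqr in_set.
have [->|_] := eqVneq x y; first by rewrite y0.
by have [->|_] := eqVneq x (- y); rewrite ?oppr_eq0 ?y0 ?andbF.
Qed.

(** The nonzero squares and their multiples by [K] partition the units: they are disjoint, and each
    set holds half of the units. *)
Lemma sum_comp_nonsquare (V : nmodType) (f : F -> V) (K : F) :
    (forall y, K != y ^+ 2) ->
  \sum_k f (k ^+ 2) + \sum_k f (K * k ^+ 2) = (\sum_x f x) *+ 2.
Proof.
move=> nsqK; have K0 : K != 0 by have := nsqK 0; rewrite expr0n.
have K_inj : {in squares &, injective ( *%R K)} by move=> x y _ _ /(mulfI K0).
rewrite !(sum_comp_sqr V) (sum_comp_sqr V (fun x => f (K * x))) mulr0.
rewrite -(big_imset f K_inj) /=; set sq := squares.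
set nonsq := [set K * r | r in sq].
have disj : [disjoint sq & nonsq].
  rewrite disjoint_subset; apply/subsetP => _ /imsetP[y _ ->]; rewrite inE.
  apply/imsetP => -[_ /imsetP[z z_unit ->]] /eqP; apply/negP.
  move: z_unit; rewrite inE => z0; apply: contra (nsqK (y / z)) => /eqP yKz.
  by rewrite expr_div_n yKz mulfK // expf_neq0.
(* Apply [sum_comp_sqr] to the constant 1. *)
have card_sq : #|units| = (#|sq| * 2)%N.
  have := sum_comp_sqr nat (fun=> 1%N).
  rewrite (bigD1 0) //= => /addnI.
  rewrite !sum1_card mulr2n => E; rewrite muln2 -addnn -[RHS]E.
  by apply: eq_card => x; rewrite in_set.
have sqU : sq :|: nonsq = units.
  apply/eqP; rewrite eqEcard cardsU disjoint_setI0 // cards0 subn0 card_sq.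
  rewrite (card_in_imset K_inj) addnn muln2 leqnn andbT.
  by apply/subsetP => _ /setUP[/imsetP[y + ->]|/imsetP[_ /imsetP[y + ->] ->]];
     rewrite !in_set => y0; rewrite ?mulf_neq0 ?expf_neq0.
have -> : \sum_x f x = f 0 + (\sum_(r in sq) f r + \sum_(r in nonsq) f r).
  rewrite (bigD1 0) //= -bigU //=; congr (_ + _); apply: eq_bigl => x.
  by move/setP/(_ x): sqU; rewrite in_setU [x \in units]in_set => <-.
by rewrite !mulrnDl mulr2n addrACA.
Qed.

End SquareSums.

(** * Gauss sums over ['F_n] and the trace *)

Section QuadraticGaussSum.
Variables (R : realType) (n : nat).
Hypotheses (n_prime : prime n) (n_odd : odd n).
Implicit Types (q : R[i]) (x K : 'F_n).

Lemma sum_Fp (V : nmodType) (f : 'F_n -> V) :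
  \sum_x f x = \sum_(k < n) f k%:R.
Proof.
under eq_bigr do rewrite -[X in f X]natr_Zp.
rewrite -(big_mkord xpredT (fun k => f k%:R)).
rewrite -(big_mkord xpredT (fun k => f k%:R)).
have <- // : index_iota 0 (Zp_trunc (pdiv n)).+2 = index_iota 0 n.
by rewrite Fp_Zcast // Zp_cast // prime_gt1.
Qed.

Lemma qpow_nat q k : q ^+ n = 1 -> qpow q (k%:R : 'F_n) = q ^+ k.
Proof. by move=> qn; rewrite /qpow val_Fp_nat // expr_mod. Qed.

Lemma qpowXn q m x : q ^+ n = 1 -> qpow (q ^+ m) x = qpow q (m%:R * x).
Proof.
move=> qn; rewrite -[x in RHS]natr_Zp -natrM qpow_nat //.
by rewrite /qpow exprM.
Qed.

Lemma sum_qpow q : n.-primitive_root q -> \sum_(x : 'F_n) qpow q x = 0.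
Proof.
move=> q_prim; have qn := prim_expr_order q_prim.
rewrite sum_Fp; under eq_bigr do rewrite qpow_nat //.
have q1 : q - 1 != 0.
  rewrite subr_eq0 -[q]expr1 -(prim_order_dvd q_prim) dvdn1.
  by rewrite gtn_eqF // prime_gt1.
by apply: (mulfI q1); rewrite -subrX1 qn subrr mulr0.
Qed.

(** A square [K] is absorbed by rescaling [k]; for a nonsquare the two sums add up to twice the sum
    of all powers of [q], which is 0. *)
Lemma sum_qpow_legendre q K : n.-primitive_root q -> K != 0 ->
  \sum_k qpow q (K * k ^+ 2) =
  (legendre K)%:~R * \sum_k qpow q (k ^+ 2 : 'F_n).
Proof.
move=> q_prim K0; rewrite /legendre (negPf K0).
case: existsP => [[y /eqP Ky]|nsqK].
  have y0 : y != 0 by apply: contraNneq K0; rewrite Ky => ->; rewrite expr0n.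
  rewrite mul1r [RHS](reindex_inj (mulfI y0)) /=.
  by apply: eq_bigr => k _; rewrite exprMn Ky.
rewrite mulN1r; apply/eqP; rewrite -addr_eq0 addrC.
rewrite (@sum_comp_nonsquare _ _ _ (qpow q)) ?sum_qpow ?mul0rn //.
  rewrite -(dvdn_pcharf (pchar_Fp n_prime)) gtnNdvd //.
  exact: odd_prime_gt2.
by move=> y; apply/negP => Ky; apply: nsqK; exists y.
Qed.

(** On the diagonal [j - a k = (1 - a) k], so the exponent is a multiple of [k^2]. *)
Lemma trace_Cmx q (B : 'M[int]_2) :
  \tr (Cmx n q B) = \sum_k qpow q (KB n B * k ^+ 2).
Proof.
rewrite sum_Fp; apply: eq_bigr => k _; rewrite mxE /KB; congr qpow; ring.
Qed.

End QuadraticGaussSum.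

Theorem theorem10 (R : realType) (n : nat) (q : R[i]) (B : 'M[int]_2)
    (n_prime : prime n) (n_odd : odd n)
    (q_prim : n.-primitive_root q)
    (detB : \det B = 1)
    (b_neq0 : (B 0 1)%:~R != 0 :> 'F_n)
    (K_neq0 : KB n B != 0) :
  (q = zeta R n ->
     \tr (Cmx n q B) =
       (legendre (KB n B))%:~R
       * ((1 + ('i%C) ^- n) / (1 + ('i%C)^-1)) * (Num.sqrt (n%:R : R))%:C)
  /\
  (forall m : nat, q = zeta R n ^+ m ->
     \tr (Cmx n q B) =
       (legendre (m%:R : 'F_n))%:~R
       * ((legendre (KB n B))%:~R
          * ((1 + ('i%C) ^- n) / (1 + ('i%C)^-1)) * (Num.sqrt (n%:R : R))%:C)).
Proof.
have gauss_sum : n.-primitive_root (zeta R n) ->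
    \sum_k qpow (zeta R n) (k ^+ 2 : 'F_n) =
    (1 + 'i%C ^- n) / (1 + 'i%C^-1) * (Num.sqrt (n%:R : R))%:C.
  move=> z_prim; rewrite sum_Fp // -sum_zeta_sqr //; apply: eq_bigr => k _.
  by rewrite -natrX qpow_nat // zeta_order // prime_gt0.
rewrite trace_Cmx // sum_qpow_legendre //; split => [qz|m qz].
  by rewrite qz gauss_sum -?qz // mulrA.
(* The order of [zeta] divides the prime [n]; order 1 would give [q = 1]. *)
have z_prim : n.-primitive_root (zeta R n).
  have n_gt0 := prime_gt0 n_prime.
  have [d d_prim] := prim_order_exists n_gt0 (zeta_order R n n_gt0).
  case/primeP: (n_prime) => _ /[apply]/orP[]/eqP dE.
    2: by rewrite dE in d_prim.
  move: (prime_gt1 n_prime).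
  have : (n %| 1)%N.
    rewrite (prim_order_dvd q_prim) expr1 qz -(expr1n _ m).
    by move: d_prim; rewrite dE => /prim_expr_order; rewrite expr1 => ->.
  by rewrite dvdn1 => /eqP ->.
have m0 : m%:R != 0 :> 'F_n.
  rewrite -(dvdn_pcharf (pchar_Fp n_prime)); apply/negP => /dvdnP[k mE].
  have : (n %| 1)%N.
    by rewrite (prim_order_dvd q_prim) expr1 qz mE mulnC exprM zeta_order
               ?prime_gt0 // expr1n.
  by rewrite dvdn1 => /eqP n1; rewrite n1 in n_prime.
rewrite qz.
(* The power [m] becomes a factor of the exponent, giving a second Legendre twist. *)
under [X in _ * X]eq_bigr do rewrite qpowXn ?zeta_order ?prime_gt0 //.
by rewrite sum_qpow_legendre // gauss_sum // mulrCA !mulrA.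
Qed.
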